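(* Let $1 \leq k \leq n$ be integers and consider the absent-minded passengers process with $k$ absent-minded passengers: there are $n$ seats labelled $1,\dots,n$ and $n$ passengers labelled $1,\dots,n$, where the correct seat of passenger $i$ is seat $i$. Passengers board in the order $1,2,\dots,n$. Each of the passengers $1,\dots,k$ chooses a seat uniformly at random among the currently empty seats. Each passenger $i>k$ takes seat $i$ if it is still empty, and otherwise chooses a seat uniformly at random among the currently empty seats. Let $f^{(k)}_n(w)$ be the polynomial in $w$ whose coefficient of $w^l$ is the probability that exactly $l$ passengers end up in a seat other than their own. Then $$f^{(k)}_n(w)=\frac{1}{n!}\sum_{r=0}^{k} r!\binom{k}{r} w^r (1-w)^{k-r}\prod_{i=1}^{n-k}(rw+i).$$
   Context: An empty product equals $1$. *)

(* Defs.v *)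
From HB Require Import structures.
From mathcomp Require Import all_boot all_order all_algebra.

Set Implicit Arguments.
Unset Strict Implicit.
Unset Printing Implicit Defensive.

Import Order.TTheory GRing.Theory Num.Theory.
Local Open Scope ring_scope.

(* Passengers and seats are indexed from 0: the passenger    *)
(* (or seat) labelled i.+1 is the element i of 'I_n, so the absent-minded     *)
(* passengers 1, ..., k are the indices i < k.                                *)

Section AbsentMindedPassengers.
Variables (R : realFieldType) (n k : nat).

(* A seating s sends each passenger to the seat they end up in.  It is not    *)
(* required to be injective: [seating_prob] vanishes on the s that are not.   *)
Definition seating : predArgType := {ffun 'I_n -> 'I_n}.

Definition empty_seats (s : seating) (i : 'I_n) : {set 'I_n} :=
  ~: [set s j | j : 'I_n & (j < i)%N].

(* Probability that passenger i chooses seat x when E is the set of currently *)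
(* empty seats.                                                               *)
Definition choice_prob (E : {set 'I_n}) (i x : 'I_n) : R :=
  if (i < k)%N || (i \notin E) then (x \in E)%:R / #|E|%:R else (x == i)%:R.

(* Chain rule: the conditional law of the choice of passenger i given the     *)
(* choices of the passengers j < i is [choice_prob (empty_seats s i) i].      *)
Definition seating_prob (s : seating) : R :=
  \prod_(i < n) choice_prob (empty_seats s i) i (s i).

Definition misplaced (s : seating) : nat := #|[set i : 'I_n | s i != i]|.

Definition misplaced_prob (l : nat) : R :=
  \sum_(s : seating | misplaced s == l) seating_prob s.

Definition misplaced_poly : {poly R} := \poly_(l < n.+1) misplaced_prob l.

End AbsentMindedPassengers.

(* Main.v *)
(* Fix the boarding order i_1, ..., i_n, and let v(l, E) be the expected value
   of 'X^(number of misplaced passengers in l) when the passengers still to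
   board are those of the list l and the set of empty seats is E.  Instead of a
   single E one sums v(l, E) over all the E of size |l| inside a set U of |l| + r
   seats containing those of l.  Removing the first passenger i of l gives
     S(i :: l, U) = (r 'X + |l| + 1) / (|l| + 1) * S(l, U \ i)
   when i is not absent-minded, and, writing 'X^[x != i] = 'X + (1 - 'X) [x = i],
     S(i :: l, U) = ((r + 1) 'X S(l, U) + (1 - 'X) S(l, U \ i)) / (|l| + 1)
   when i is absent-minded.  So S(l, U) depends only on r and on the two numbers
   of passengers; solving the recurrences and taking U to be the set of all
   seats, i.e. r = 0, gives the formula. *)
Require Import Defs.
From HB Require Import structures.
From mathcomp Require Import all_boot all_order all_algebra.

Set Implicit Arguments.
Unset Strict Implicit.
Unset Printing Implicit Defensive.

Import Order.TTheory GRing.Theory Num.Theory.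
Local Open Scope ring_scope.

(** * Sums over successive choices, and double counting of subsets *)

Section ChainSum.
Variables (T : finType) (A : comNzRingType).

(** Recursion on the list lets passengers be removed one at a time. The sum over [x] is
    unrestricted, so it is [g] that must vanish on forbidden choices. *)
Fixpoint chain_sum (I : Type) (g : I -> {set T} -> T -> A) (l : seq I)
    (E : {set T}) : A :=
  if l is i :: l' then \sum_x g i E x * chain_sum g l' (E :\ x) else 1.

Lemma chain_sum_map (I J : Type) (f : I -> J) g l E :
  chain_sum g (map f l) E = chain_sum (fun i => g (f i)) l E.
Proof.
elim: l E => //= i l IHl E.
by apply: eq_bigr => x _; rewrite IHl.
Qed.

Definition ffun_cons n (p : T * {ffun 'I_n -> T}) : {ffun 'I_n.+1 -> T} :=
  [ffun i => if unlift ord0 i is Some j then p.2 j else p.1].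

Lemma ffun_cons_bij n : bijective (@ffun_cons n).
Proof.
exists (fun s : {ffun 'I_n.+1 -> T} => (s ord0, [ffun j => s (lift ord0 j)])).
  case=> x s; congr (_, _); first by rewrite ffunE unlift_none.
  by apply/ffunP=> j; rewrite !ffunE liftK.
move=> s; apply/ffunP=> i; rewrite ffunE.
by case: unliftP => [j|] -> //; rewrite ffunE.
Qed.

Lemma ffun_cons0 n x (s : {ffun 'I_n -> T}) : ffun_cons (x, s) ord0 = x.
Proof. by rewrite ffunE unlift_none. Qed.

Lemma ffun_consS n x (s : {ffun 'I_n -> T}) j :
  ffun_cons (x, s) (lift ord0 j) = s j.
Proof. by rewrite ffunE liftK. Qed.

Lemma imset_ffun_cons n x (s : {ffun 'I_n -> T}) (i : 'I_n) :
  [set ffun_cons (x, s) j | j : 'I_n.+1 & (j < lift ord0 i)%N]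
    = x |: [set s j | j : 'I_n & (j < i)%N].
Proof.
apply/setP=> y; rewrite !inE; apply/imsetP/orP => [[j]|[/eqP ->|/imsetP[j]]].
- rewrite inE; case: (unliftP ord0 j) => [j'|] -> lt_ji ->.
    by right; apply/imsetP; exists j'; rewrite ?ffun_consS ?inE.
  by left; rewrite ffun_cons0.
- by exists ord0; rewrite ?inE ?ffun_cons0.
rewrite inE => lt_ji ->; exists (lift ord0 j); rewrite ?ffun_consS ?inE //.
Qed.

(** Distributivity: splitting off the value at [ord0] with [ffun_cons] factors out the first choice
    [x], and the later choices see [E :\ x]. *)
Lemma sum_ffun_chain n (g : 'I_n -> {set T} -> T -> A) (E : {set T}) :
  \sum_(s : {ffun 'I_n -> T})
     \prod_(i < n) g i (E :\: [set s j | j : 'I_n & (j < i)%N]) (s i)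
    = chain_sum g (enum 'I_n) E.
Proof.
elim: n g E => [|n IHn] g E.
  under eq_bigr do rewrite big_ord0.
  rewrite sumr_const card_ffun card_ord expn0.
  by have /size0nil-> : size (enum 'I_0) = 0%N by rewrite size_enum_ord.
rewrite enum_ordSl /= (reindex (@ffun_cons n)) /=; last first.
  exact: onW_bij (@ffun_cons_bij n).
rewrite -(pair_bigA _ (fun x s => \prod_(i < n.+1)
   g i (E :\: [set ffun_cons (x, s) j | j : 'I_n.+1 & (j < i)%N])
     (ffun_cons (x, s) i))) /=.
apply: eq_bigr => x _; rewrite chain_sum_map -IHn big_distrr /=.
apply: eq_bigr => s _; rewrite big_ord_recl ffun_cons0; congr (_ * _).
  (* Nobody boards before [ord0], so the set removed from [E] is empty. *)
  congr (g _ _ _); apply/setP=> y; rewrite inE.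
  by case: imsetP => // -[j]; rewrite inE.
by apply: eq_bigr => i _; rewrite ffun_consS imset_ffun_cons setDDl.
Qed.

(** Removing [i] is a bijection from the sets [E] containing [i] to the sets avoiding it, with
    inverse [i |: E]. *)
Lemma sum_subset_setD1 (h : {set T} -> A) (U : {set T}) i j : i \in U ->
  \sum_(E : {set T} | (E \subset U) && (#|E| == j.+1)) (i \in E)%:R * h (E :\ i)
    = \sum_(E : {set T} | (E \subset U :\ i) && (#|E| == j)) h E.
Proof.
move=> Ui; rewrite (bigID (fun E : {set T} => i \in E)) /= addrC big1 ?add0r.
  rewrite (reindex_onto (fun E => i |: E) (fun E => E :\ i)) /=; last first.
    by move=> E /andP[_ Ei]; rewrite setD1K.
  apply: eq_big => [E|E /andP[_ /eqP ->]]; last by rewrite setU11 mul1r.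
  rewrite setU11 andbT subUset sub1set Ui /= subsetD1 -andbA.
  have [Ei|Ei] := boolP (i \in E); last first.
    by rewrite setU1K // eqxx cardsU1 Ei add1n eqSS !andbT.
  rewrite /= !andbF; apply/negbTE; rewrite !negb_and; apply/orP; right.
  by apply/orP; right; apply: contraTneq Ei => <-; rewrite !inE eqxx.
by move=> E /andP[_ /negbTE ->]; rewrite mul0r.
Qed.

(** Double counting: a set [F] of size [j] in [U] arises as [E :\ x] exactly once for each [x] in
    [U :\: F]. *)
Lemma sum_subset_sum_setD1 (h : {set T} -> A) (U : {set T}) j :
  \sum_(E : {set T} | (E \subset U) && (#|E| == j.+1)) \sum_(x in E) h (E :\ x)
    = (#|U| - j)%:R *
      \sum_(E : {set T} | (E \subset U) && (#|E| == j)) h E.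
Proof.
transitivity (\sum_(x in U)
    \sum_(E : {set T} | (E \subset U :\ x) && (#|E| == j)) h E).
  rewrite (eq_bigr (fun x => \sum_(E : {set T} |
    (E \subset U) && (#|E| == j.+1)) (x \in E)%:R * h (E :\ x))); last first.
    by move=> x Ux; rewrite sum_subset_setD1.
  rewrite exchange_big /=; apply: eq_bigr => E /andP[/subsetP sEU _].
  rewrite [RHS](bigID (fun x => x \in E)) /= [X in _ + X]big1 ?addr0.
    apply: eq_big => [x|x Ex]; last by rewrite Ex mul1r.
    by case Ex: (x \in E); rewrite ?andbF // sEU.
  by move=> x /andP[_ /negbTE ->]; rewrite mul0r.
rewrite (exchange_big_dep (fun E : {set T} => (E \subset U) && (#|E| == j))) /=.
  rewrite big_distrr /=; apply: eq_bigr => E /andP[sEU /eqP cardE].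
  rewrite (eq_bigl (fun x => x \in U :\: E)); last first.
    by move=> x; rewrite subsetD1 sEU cardE eqxx inE andbT andbC.
  by rewrite sumr_const cardsD (setIidPr sEU) cardE mulr_natl.
by move=> x E _ /andP[sEU ->]; rewrite (subset_trans sEU) ?subD1set.
Qed.

End ChainSum.

(** * The binomial transform that solves the absent-minded recurrence *)

Section BinomialTransform.
Variable R : comNzRingType.
Implicit Types (c : nat -> {poly R}) (k r : nat).

(** The value at [r] of the [k]-th iterate of the operator sending [c] to
    ['X * c r.+1 + (1 - 'X) * c r], expanded by the binomial theorem. *)
Definition binom_mix c k r : {poly R} :=
  \sum_(0 <= s < k.+1) 'C(k, s)%:R *: ('X^s * (1 - 'X) ^+ (k - s) * c (r + s)%N).

Lemma binom_mixS c k r :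
  binom_mix c k.+1 r = 'X * binom_mix c k r.+1 + (1 - 'X) * binom_mix c k r.
Proof.
rewrite /binom_mix !big_mkord big_ord_recl [in RHS]big_distrr /=.
(* The term [s = 0] is split off and the null term with ['C(k, k.+1)] is appended, so that Pascal's
   rule applies termwise. *)
have -> : (1 - 'X) * (\sum_(s < k.+1)
      'C(k, s)%:R *: ('X^s * (1 - 'X) ^+ (k - s) * c (r + s)%N)) =
    (1 - 'X) ^+ k.+1 * c r + \sum_(s < k.+1)
      'C(k, s.+1)%:R *: ('X^(s.+1) * (1 - 'X) ^+ (k - s) * c (r + s.+1)%N).
  rewrite big_ord_recl /= [in RHS]big_ord_recr /= (bin_small (ltnSn k)) scale0r addr0.
  rewrite mulrDr big_distrr /= bin0 scale1r expr0 mul1r subn0 addn0.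
  rewrite mulrA -exprS; congr (_ + _); apply: eq_bigr => s _.
  rewrite /bump add1n -scalerAr (mulrA (1 - 'X)) (mulrCA (1 - 'X)) -exprS.
  by rewrite -subSn // subSS.
rewrite addrCA /= bin0 scale1r expr0 mul1r subn0 addn0; congr (_ + _).
rewrite -big_split /=; apply: eq_bigr => s _.
rewrite /bump add1n binS natrD scalerDl addrC subSS; congr (_ + _).
by rewrite -scalerAr !mulrA -exprS addSnnS.
Qed.

End BinomialTransform.

(** * Generating polynomials of the boarding process *)

Section Boarding.
Variables (R : realFieldType) (n k : nat).
Implicit Types (i x : 'I_n) (E U : {set 'I_n}) (l : seq 'I_n).

Definition boarding_weight i E x : {poly R} :=
  choice_prob R k E i x *: 'X^(x != i).

Definition boarding_poly l E : {poly R} := chain_sum boarding_weight l E.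

(** This is S(l, U), and [boarding_poly] is v(l, E). *)
Definition boarding_sum l U : {poly R} :=
  \sum_(E : {set 'I_n} | (E \subset U) && (#|E| == size l)) boarding_poly l E.

Lemma misplaced_polyE :
  misplaced_poly R n k = boarding_poly (enum 'I_n) setT.
Proof.
rewrite /boarding_poly -sum_ffun_chain /misplaced_poly poly_def.
(* [inord] loses nothing here, since at most [n] passengers are misplaced. *)
rewrite [RHS](partition_big (fun s : seating n => inord (misplaced s) : 'I_n.+1)
  predT) //=; apply: eq_bigr => l _.
rewrite /misplaced_prob scaler_suml; apply: eq_big => s.
  by rewrite -val_eqE /= inordK // ltnS (leq_trans (max_card _)) ?card_ord.
move/eqP => <-; rewrite /seating_prob /misplaced.
rewrite [in RHS]/boarding_weight scaler_prod; congr (_ *: _).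
  by apply: eq_bigr => i _; rewrite /empty_seats setTD.
by rewrite prodrXr -sum1dep_card big_mkcond; congr ('X^_); apply: eq_bigr.
Qed.

Lemma boarding_poly_absent i l E : (i < k)%N ->
  boarding_poly (i :: l) E = (#|E|%:R^-1 : R) *:
    ('X * \sum_(x in E) boarding_poly l (E :\ x)
     + (1 - 'X) * ((i \in E)%:R * boarding_poly l (E :\ i))).
Proof.
move=> lt_ik; rewrite /boarding_poly /=.
set P := chain_sum boarding_weight l.
have wE x : boarding_weight i E x =
    (#|E|%:R^-1 : R) *: ((x \in E)%:R * ('X + (1 - 'X) * (x == i)%:R)).
  rewrite /boarding_weight /choice_prob lt_ik /= mulrC -scalerA; congr (_ *: _).
  case: (x \in E); rewrite ?scale0r ?mul0r // scale1r mul1r.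
  by case: eqP => _; rewrite ?mulr1 ?mulr0 ?addr0 // addrC subrK.
under eq_bigr do rewrite wE -scalerAl.
rewrite -scaler_sumr; congr (_ *: _).
under [LHS]eq_bigr do rewrite mulrDr mulrDl.
rewrite big_split /=; congr (_ + _).
  rewrite big_distrr [RHS]big_mkcond /=; apply: eq_bigr => x _.
  by case: (x \in E); rewrite ?mul1r ?mul0r.
rewrite (bigD1 i) //= big1 ?addr0 => [|x /negbTE->]; last by rewrite !mulr0 mul0r.
by rewrite eqxx mulr1 mulrCA mulrA.
Qed.

Lemma boarding_poly_present i l E : (k <= i)%N ->
  boarding_poly (i :: l) E = (i \in E)%:R * boarding_poly l (E :\ i)
    + (i \notin E)%:R * ((#|E|%:R^-1 : R) *:
        ('X * \sum_(x in E) boarding_poly l (E :\ x))).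
Proof.
rewrite leqNgt => /negbTE le_ki; rewrite /boarding_poly /=.
rewrite /boarding_weight /choice_prob le_ki /=.
set P := chain_sum _ l.
have [Ei|Ei] /= := boolP (i \in E).
  rewrite mul0r addr0 (bigD1 i) //= big1 ?addr0 => [|x /negbTE->].
    by rewrite eqxx scale1r.
  by rewrite scale0r mul0r.
rewrite mul0r add0r mul1r big_distrr scaler_sumr [RHS]big_mkcond /=.
apply: eq_bigr => x _; have [Ex|] := boolP (x \in E); last first.
  by rewrite !mul0r scale0r mul0r.
have -> : x != i by apply: contraNneq Ei => <-.
by rewrite mul1r -scalerAl.
Qed.

Lemma boarding_sum_absent i l U : (i < k)%N -> i \in U ->
  boarding_sum (i :: l) U = ((size l).+1%:R^-1 : R) *:
    ((#|U| - size l)%:R * 'X * boarding_sum l U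
     + (1 - 'X) * boarding_sum l (U :\ i)).
Proof.
move=> lt_ik Ui; rewrite /boarding_sum /= -(sum_subset_setD1 _ _ Ui).
rewrite (mulrC _ 'X) -mulrA -sum_subset_sum_setD1 !big_distrr -big_split /=.
rewrite scaler_sumr; apply: eq_bigr => E /andP[_ /eqP cardE].
by rewrite boarding_poly_absent // cardE.
Qed.

(** The sets [E] containing [i] give the summand 1. Those avoiding [i] lie in [U :\ i], every choice
    from them is a wrong seat, and double counting inside [U :\ i] gives the other summand. *)
Lemma boarding_sum_present i l U : (k <= i)%N -> i \in U ->
  boarding_sum (i :: l) U =
    (1 + ((size l).+1%:R^-1 : R) *: ((#|U :\ i| - size l)%:R * 'X))
      * boarding_sum l (U :\ i).
Proof.
move=> le_ki Ui; rewrite /boarding_sum /= mulrDl mul1r.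
rewrite -scalerAl (mulrC _ 'X) -mulrA -sum_subset_sum_setD1.
rewrite -(sum_subset_setD1 _ _ Ui).
under eq_bigr => E _ do rewrite boarding_poly_present //.
rewrite big_split /=; congr (_ + _).
rewrite big_distrr scaler_sumr [RHS](eq_bigl (fun E : {set 'I_n} =>
  (E \subset U) && (#|E| == (size l).+1) && (i \notin E))) /=; last first.
  by move=> E; rewrite subsetD1 -!andbA [(i \notin E) && _]andbC.
rewrite [RHS]big_mkcondr /=; apply: eq_bigr => E /andP[_ /eqP cardE].
by rewrite cardE; case: (i \notin E); rewrite ?mul1r ?mul0r.
Qed.

Definition rising_poly m r : {poly R} :=
  \prod_(1 <= i < m.+1) (r%:R *: 'X + i%:R%:P).

(** The passenger [i] leaves both [l] and [U], so the excess [r] stays constant and the recurrence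
    factors multiply up. *)
Lemma boarding_sum_all_present l U r : uniq l -> {subset l <= U} ->
    (forall i, i \in l -> k <= i)%N -> #|U| = (size l + r)%N ->
  boarding_sum l U = ((size l)`!%:R^-1 : R) *: rising_poly (size l) r.
Proof.
elim: l U => [|i l IHl] U /= uniq_l sub_lU le_kl cardU.
  rewrite /rising_poly big_geq // fact0 invr1 scale1r /boarding_sum.
  rewrite (big_pred1 set0) // => E /=.
  by rewrite cards_eq0 andb_idl // => /eqP->; rewrite sub0set.
case/andP: uniq_l => il uniq_l; have Ui : i \in U by rewrite sub_lU ?mem_head.
have cardU' : #|U :\ i| = (size l + r)%N.
  by move: cardU; rewrite (cardsD1 i) Ui addSn add1n => -[].
rewrite boarding_sum_present ?le_kl ?mem_head // cardU' addKn IHl //.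
- rewrite /rising_poly [in RHS]big_nat_recr //= factS natrM invfM.
  rewrite -[in RHS]scalerA.
  rewrite [in RHS]mulrC [in RHS]scalerAr [in RHS]scalerAl; congr (_ * _).
  rewrite scalerDr addrC -!mul_polyC -polyCM mulVf ?pnatr_eq0 //.
  by rewrite polyC_natr.
- move=> j lj; rewrite !inE sub_lU ?inE ?lj ?orbT // andbT.
  by apply: contraNneq il => <-.
- by move=> j lj; rewrite le_kl ?inE ?lj ?orbT.
Qed.

(** Dropping an absent-minded passenger but keeping the seat raises [r] by one; dropping both leaves
    [r] fixed. Normalising by [r!] absorbs the coefficient [r.+1], which turns the recurrence into
    [binom_mixS]. *)
Lemma boarding_sum_cat a l U r : uniq (a ++ l) -> {subset a ++ l <= U} ->
    (forall i, i \in a -> i < k)%N -> (forall i, i \in l -> k <= i)%N ->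
    #|U| = (size (a ++ l) + r)%N ->
  boarding_sum (a ++ l) U = (((size (a ++ l))`! * r`!)%:R^-1 : R) *:
    binom_mix (fun s => s`!%:R *: rising_poly (size l) s) (size a) r.
Proof.
elim: a U r => [|i a IHa] U r /= uniq_al sub_U lt_ak le_kl cardU.
  rewrite (@boarding_sum_all_present _ _ r) // /binom_mix big_nat1 bin0 scale1r.
  rewrite !expr0 !mul1r addn0 scalerA; congr (_ *: _).
  by rewrite natrM invfM mulfVK // pnatr_eq0 -lt0n fact_gt0.
case/andP: uniq_al => ial uniq_al; have Ui : i \in U by rewrite sub_U ?mem_head.
have sub_al j : j \in a ++ l -> j \in U.
  by move=> jal; rewrite sub_U ?inE ?jal ?orbT.
have lt_a j : j \in a -> (j < k)%N.
  by move=> ja; rewrite lt_ak ?inE ?ja ?orbT.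
rewrite boarding_sum_absent ?lt_ak ?mem_head // cardU addSn -addnS addKn.
rewrite (IHa _ r.+1) ?(IHa (U :\ i) r) //; first last.
- by rewrite cardU addSnnS.
- by move: cardU; rewrite (cardsD1 i) Ui addSn add1n => -[].
- move=> j jal; rewrite !inE sub_al // andbT.
  by apply: contraNneq ial => <-.
rewrite binom_mixS; set N := size (a ++ l).
have -> : (N.+1`! * r`!)%:R^-1 = N.+1%:R^-1 * (N`! * r`!)%:R^-1 :> R.
  by rewrite factS -mulnA natrM invfM.
have -> : (N`! * r.+1`!)%:R^-1 = r.+1%:R^-1 * (N`! * r`!)%:R^-1 :> R.
  by rewrite factS mulnCA natrM invfM.
rewrite -!scalerA (scalerDr (N`! * r`!)%:R^-1) -!scalerAr; congr (_ *: (_ + _)).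
rewrite -mulrA mulr_natl -scaler_nat !scalerA.
by rewrite mulrAC mulVf ?pnatr_eq0 ?mul1r.
Qed.

End Boarding.

Theorem theorem3 (R : realFieldType) (n k : nat) (hk1 : (1 <= k)%N)
    (hkn : (k <= n)%N) :
  misplaced_poly R n k =
    (n`!%:R)^-1 *:
      \sum_(0 <= r < k.+1)
        ((r`! * 'C(k, r))%:R *: ('X^r * (1 - 'X) ^+ (k - r) *
           \prod_(1 <= i < (n - k).+1) (r%:R *: 'X + i%:R%:P))).
Proof.
have map_val_enum : map val (enum 'I_n) = iota 0 n by rewrite val_enum_ord.
have size_enum : size (enum 'I_n) = n by rewrite size_enum_ord.
set a := take k (enum 'I_n); set l := drop k (enum 'I_n).
have enumE : enum 'I_n = a ++ l by rewrite cat_take_drop.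
have sz_a : size a = k by rewrite size_takel ?size_enum.
have sz_l : size l = (n - k)%N by rewrite size_drop size_enum.
rewrite misplaced_polyE.
(* The only set of [n] seats is [setT], so the sum S has a single term. *)
transitivity (boarding_sum R k (enum 'I_n) setT).
  rewrite /boarding_sum (big_pred1 setT) // => E /=.
  by rewrite subsetT size_enum [RHS]eqEcard subsetT cardsT card_ord leq_eqVlt
     ltnNge (leq_trans (max_card _)) ?card_ord // orbF eq_sym.
(* There are as many seats as passengers, hence excess 0; as [enum 'I_n] is increasing, [a] holds
   exactly the absent-minded passengers. *)
rewrite enumE (@boarding_sum_cat _ _ _ a l setT 0); first last.
- by rewrite -enumE size_enum cardsT card_ord addn0.
- move=> i il; have: val i \in map val l by rewrite map_f.
  by rewrite map_drop map_val_enum drop_iota mem_iota => /andP[].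
- move=> i ia; have: val i \in map val a by rewrite map_f.
  by rewrite map_take map_val_enum take_iota mem_iota (minn_idPl hkn).
- by move=> i _; rewrite inE.
- by rewrite -enumE enum_uniq.
rewrite -enumE size_enum sz_a sz_l fact0 muln1; congr (_ *: _).
by apply: eq_bigr => s _; rewrite add0n -scalerAr scalerA natrM mulrC.
Qed.
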